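(* For any graph $G$, $\ell_G \leq \gamma_P(G)$.
   Context: All graphs are simple and finite, with nonempty vertex set. For a graph $G$ and $S\subseteq V(G)$, vertices are observed by the following rules. Initialization (domination) step, applied once: all vertices in $S$ and all neighbors of vertices in $S$ are observed. Propagation (zero forcing) step, applied repeatedly until no further vertex can be observed: every vertex which is the only unobserved neighbor of some observed vertex becomes observed. The set $S$ is a power dominating set of $G$ (one says $S$ power dominates $G$) if every vertex of $G$ is eventually observed. The power domination number $\gamma_P(G)$ is the minimum cardinality of a power dominating set of $G$. A partition $\Pi = \Pi_1 \cup \cdots \cup \Pi_k$ of $V(G)$ with $k\ge 2$ is a failed power dominating partition of $G$ if for each $i\in\{1,\dots,k\}$, the set $V(G)-\Pi_i$ does not power dominate $G$. If such a partition exists, $\ell_G$ is the maximum $j$ such that $G$ has a failed power dominating partition $\Pi_1\cup\cdots\cup\Pi_j$ into $j$ parts; if no such partition exists, $\ell_G=1$. *)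

(* Defs.v *)
From mathcomp Require Import all_boot.
Set Implicit Arguments.
Unset Strict Implicit.
Unset Printing Implicit Defensive.

(* A simple graph is a finite vertex type T with a symmetric irreflexive
   adjacency relation e. *)
Section PowerDomination.
Variables (T : finType) (e : rel T).
Implicit Types (S O : {set T}) (P : {set {set T}}).

Definition nbhd (v : T) : {set T} := [set w | e v w].

Definition dominate S : {set T} := S :|: \bigcup_(v in S) nbhd v.

(* One simultaneous round of forcing: w becomes observed when, for some
   observed v, the set of unobserved neighbours of v is exactly {w}. *)
Definition propagate O : {set T} :=
  O :|: [set w | [exists v in O, nbhd v :\: O == [set w]]].

(* #|T| rounds suffice for no further vertex to be observed; see
   propagate_observed. *)
Definition observed S : {set T} := iter #|T| propagate (dominate S).

Definition power_dominating S : bool := observed S == [set: T].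

Lemma subset_propagate O : O \subset propagate O.
Proof. exact: subsetUl. Qed.

Lemma propagate_observed S : propagate (observed S) = observed S.
Proof.
pose O n := iter n propagate (dominate S).
have grow n : propagate (O n) = O n \/ n < #|propagate (O n)|.
  elim: n => [|n [IHn|IHn]].
  - have [eqO|neO] := eqVneq (propagate (O 0)) (O 0); first by left.
    right; apply: leq_ltn_trans (leq0n #|O 0|) _.
    by apply: proper_card; rewrite properEneq eq_sym neO subset_propagate.
  - by left; rewrite /O iterS -/(O n) IHn.
  - have [eqO|neO] := eqVneq (propagate (O n.+1)) (O n.+1); first by left.
    right; apply: leq_ltn_trans IHn _.
    by apply: proper_card; rewrite properEneq eq_sym neO subset_propagate.
have [//|] := grow #|T|.
by rewrite ltnNge max_card.
Qed.

Lemma power_dominating_setT : power_dominating [set: T].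
Proof.
rewrite /power_dominating -subTset /observed.
elim: #|T| => [|n IHn]; first exact: subsetUl.
by rewrite iterS; apply: subset_trans IHn (subset_propagate _).
Qed.

(* The default [set: T] power dominates (power_dominating_setT), so the
   minimum is over a nonempty family. *)
Definition power_domination_number : nat :=
  #|[arg min_(S < [set: T] | power_dominating S) #|S|]|.

Definition failed_power_dominating_partition P : bool :=
  [&& partition P [set: T], 2 <= #|P|
    & [forall B in P, ~~ power_dominating ([set: T] :\: B)]].

Definition failed_partition_number : nat :=
  if [exists P, failed_power_dominating_partition P]
  then \max_(P | failed_power_dominating_partition P) #|P|
  else 1.

End PowerDomination.

(* Main.v *)
Require Import Defs.
From mathcomp Require Import all_boot.

(** Enlarging the initial set can only enlarge the set of observed vertices
    ([observedS]), so a superset of a power dominating set is power dominating.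
    Hence if the complement of a block [B] fails to power dominate, no power
    dominating set [S] is contained in that complement: [S] meets [B].  A power
    dominating set thus meets every block of a failed power dominating
    partition, and since the blocks are disjoint it has at least as many
    elements as there are blocks ([leq_card_failed_partition]).  When there is
    no failed partition the bound says that the power domination number is
    positive, which holds because the empty set observes nothing
    ([power_dominating_gt0]). *)

Lemma dominateS (T : finType) (e : rel T) (S S' : {set T}) :
  S \subset S' -> dominate e S \subset dominate e S'.
Proof.
move=> sSS'; apply: setUSS => //.
apply/bigcupsP => v vS; apply: bigcup_sup; exact: (subsetP sSS').
Qed.

(** If [w] is the only neighbour of [v] outside [O], then for a larger [O']
    either [w] already lies in [O'] or it is still the only neighbour of [v]
    outside [O']. *)
Lemma propagateS (T : finType) (e : rel T) (O O' : {set T}) :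
  O \subset O' -> propagate e O \subset propagate e O'.
Proof.
move=> sOO'; apply/subsetP => w; rewrite /propagate !inE.
case/orP => [/(subsetP sOO') -> //|/existsP[v /andP[vO /eqP Nv]]].
have [//|wO' /=] := boolP (w \in O').
apply/existsP; exists v; rewrite (subsetP sOO' _ vO) /= eqEsubset.
rewrite -{1}Nv setDS //= sub1set inE wO' /=.
have : w \in nbhd e v :\: O by rewrite Nv set11.
by rewrite !inE => /andP[].
Qed.

Lemma observedS (T : finType) (e : rel T) (S S' : {set T}) :
  S \subset S' -> observed e S \subset observed e S'.
Proof.
move=> sSS'; rewrite /observed.
elim: #|T| => [|n IHn] /=; [exact: dominateS | exact: propagateS].
Qed.

Lemma power_dominatingS (T : finType) (e : rel T) (S S' : {set T}) :
  S \subset S' -> power_dominating e S -> power_dominating e S'.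
Proof.
move=> sSS' /eqP obsS.
by rewrite /power_dominating -subTset -obsS observedS.
Qed.

Lemma observed0 (T : finType) (e : rel T) : observed e set0 = set0.
Proof.
rewrite /observed; elim: #|T| => [|n IHn] /=.
  by rewrite /dominate big_set0 setU0.
rewrite IHn /propagate set0U; apply/setP => w; rewrite !inE.
by apply/existsP => -[v]; rewrite inE.
Qed.

Lemma power_dominating_gt0 (T : finType) (e : rel T) (S : {set T}) :
  0 < #|T| -> power_dominating e S -> 0 < #|S|.
Proof.
move=> T_gt0 pdS; rewrite card_gt0; apply/eqP => S0.
by move: pdS T_gt0; rewrite S0 /power_dominating observed0 -cardsT => /eqP <-;
   rewrite cards0.
Qed.

(** Sending each vertex of [S] to its block reaches every block of [P]. *)
Lemma leq_card_failed_partition (T : finType) (e : rel T) (S : {set T})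
    (P : {set {set T}}) :
  power_dominating e S -> failed_power_dominating_partition e P ->
  #|P| <= #|S|.
Proof.
move=> pdS /and3P[/and3P[_ tiP _] _ /forall_inP failP].
apply: leq_trans (leq_imset_card (pblock P) S).
apply/subset_leq_card/subsetP => B PB.
have : ~~ [disjoint S & B].
  apply: contra (failP B PB) => disSB; apply: power_dominatingS pdS.
  by rewrite setTD -disjoints_subset.
case/pred0Pn => x /andP[xS xB].
by apply/imsetP; exists x; rewrite // (def_pblock tiP PB xB).
Qed.

Theorem mainTheorem3 (T : finType) (e : rel T)
    (e_sym : symmetric e) (e_irr : irreflexive e) (T_gt0 : 0 < #|T|) :
  failed_partition_number e <= power_domination_number e.
Proof.
rewrite /failed_partition_number /power_domination_number.
case: arg_minnP => [|S pdS _]; first exact: power_dominating_setT.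
case: ifP => _; last exact: power_dominating_gt0 pdS.
by apply/bigmax_leqP => P; apply: leq_card_failed_partition.
Qed.
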